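(* Let $n\ge2$, $d\ge1$, $V=\mathbb{R}^n\otimes\mathbb{R}^d\cong(\mathbb{R}^d)^n$, with $\mathcal{S}_n$ acting by permuting the $n$ factors. Then $\mathcal{O}(V)_{\mathrm{sgn}}=\mathcal{O}(V)^{\mathcal{S}_n}\big(H_{\mathcal{S}_n}(V)\cap\mathcal{O}(V)_{\mathrm{sgn}}\big)$, i.e. $H_{\mathcal{S}_n}(V)\cap\mathcal{O}(V)_{\mathrm{sgn}}$ generates $\mathcal{O}(V)_{\mathrm{sgn}}$ as an $\mathcal{O}(V)^{\mathcal{S}_n}$-module. The maximum degree of any polynomial in $H_{\mathcal{S}_n}(V)\cap\mathcal{O}(V)_{\mathrm{sgn}}$ is $\binom{n}{2}$. The minimum number of generators of $\mathcal{O}(V)_{\mathrm{sgn}}$ as an $\mathcal{O}(V)^{\mathcal{S}_n}$-module is equal to the dimension of $H_{\mathcal{S}_n}(V)\cap\mathcal{O}(V)_{\mathrm{sgn}}$ as an $\mathbb{R}$-vector space, and the module generators can be chosen to be a homogeneous polynomial basis of $H_{\mathcal{S}_n}(V)\cap\mathcal{O}(V)_{\mathrm{sgn}}$.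
   Context: $\mathcal{O}(V)=\mathbb{R}[\boldsymbol{x}_1,\dots,\boldsymbol{x}_n]$ is the ring of real polynomials in the coordinates $x_{ij}$ ($i\in[n]$, $j\in[d]$) of $\boldsymbol{x}=(\boldsymbol{x}_1,\dots,\boldsymbol{x}_n)\in(\mathbb{R}^d)^n$, $\boldsymbol{x}_i=(x_{i1},\dots,x_{id})$. The group $\mathcal{S}_n$ acts by permuting $\boldsymbol{x}_1,\dots,\boldsymbol{x}_n$. $\mathcal{O}(V)^{\mathcal{S}_n}$ is the algebra of $\mathcal{S}_n$-invariant (totally symmetric) polynomials; $\mathcal{O}_+(V)^{\mathcal{S}_n}$ is the subspace of those vanishing at $0$; $\mathcal{O}(V)_{\mathrm{sgn}}=\{f: f(\sigma.\boldsymbol{x})=\mathrm{sgn}(\sigma)f(\boldsymbol{x})\ \forall\sigma\in\mathcal{S}_n\}$ is the space of $n$-antisymmetric polynomials. For subsets $W,W'\subset\mathcal{O}(V)$, $WW'$ denotes the set of finite sums $\sum_i a_ib_i$ with $a_i\in W$, $b_i\in W'$. The inner product on $\mathcal{O}(V)$ is $\langle f,g\rangle_{\mathcal{O}(V)}=f(\partial)g\,|_{\boldsymbol{x}=0}$, where $f(\partial)$ is obtained from $f$ by replacing each $x_{ij}$ with $\partial/\partial x_{ij}$. $H_{\mathcal{S}_n}(V)$ (the $\mathcal{S}_n$-harmonic polynomials) is the orthogonal complement in $\mathcal{O}(V)$ of the ideal $\mathcal{O}(V)\mathcal{O}_+(V)^{\mathcal{S}_n}$ with respect to this inner product. *)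

(* Defs.v *)
From mathcomp Require Import all_boot all_order all_algebra all_fingroup.
From mathcomp Require Import classical_sets reals.
From mathcomp Require Import mpoly.

Set Implicit Arguments.
Unset Strict Implicit.
Unset Printing Implicit Defensive.

Import GRing.Theory.

Local Open Scope ring_scope.
Local Open Scope classical_set_scope.

(* The coordinate x_ij (i < n, j < d) of (R^d)^n is the
   variable number [mxvec_index i j] of {mpoly R[n * d]}. *)
Notation polyV R n d := {mpoly R[n * d]}.

Section PolynomialsOnV.
Variables (R : realType) (n d : nat).
Implicit Types (f g p q : polyV R n d) (W : set (polyV R n d)).

Definition coords : 'M[polyV R n d]_(n, d) :=
  \matrix_(i, j) 'X_(mxvec_index i j).

Definition subst_mx f (M : 'M[polyV R n d]_(n, d)) : polyV R n d :=
  f \mPo [tuple mxvec M 0 k | k < n * d].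

(* f(s.x), where s.x = (x_(s^-1 1), ..., x_(s^-1 n)) *)
Definition act_perm (s : 'S_n) f : polyV R n d :=
  subst_mx f (row_perm s^-1%g coords).

Definition inv_polys : set (polyV R n d) :=
  [set f | forall s : 'S_n, act_perm s f = f].

Definition inv_polys_plus : set (polyV R n d) :=
  inv_polys `&` [set f | f.@[fun=> 0] = 0].

Definition sgn_polys : set (polyV R n d) :=
  [set f | forall s : 'S_n, act_perm s f = (-1) ^+ s *: f].

(* The set WW' of all finite sums of products a * b, with a in W, b in W'. *)
Definition sumprod W W' : set (polyV R n d) :=
  [set f | exists s : seq (polyV R n d * polyV R n d),
     (forall ab, ab \in s -> W ab.1 /\ W' ab.2) /\
     f = \sum_(ab <- s) ab.1 * ab.2].

(* f(d/dx) g *)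
Definition diffop f g : polyV R n d :=
  \sum_(m <- msupp f) f@_m *: g^`M[m].

Definition inner f g : R := (diffop f g).@[fun=> 0].

Definition harmonics : set (polyV R n d) :=
  [set h | forall p, sumprod [set: polyV R n d] inv_polys_plus p ->
     inner p h = 0].

Definition generates_sgn W : Prop :=
  sgn_polys = sumprod inv_polys W.

(* [msize f] is the degree of f plus one, and 0 for f = 0. *)
Definition max_degree W (m : nat) : Prop :=
  (exists2 f, W f & msize f = m.+1) /\
  (forall f, W f -> (msize f <= m.+1)%N).

(* The vector space [polyV R n d] has infinite dimension, hence is not a
   [vectType]: linear bases of subspaces are spelled out. *)
Definition linear_basis W (k : nat) (e : k.-tuple (polyV R n d)) : Prop :=
  W = [set f | exists c : 'I_k -> R, f = \sum_(i < k) c i *: tnth e i] /\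
  (forall c : 'I_k -> R,
     \sum_(i < k) c i *: tnth e i = 0 -> forall i, c i = 0).

Definition has_dimension W (k : nat) : Prop :=
  exists e : k.-tuple (polyV R n d), linear_basis W e.

Definition min_generators_sgn (k : nat) : Prop :=
  (exists e : k.-tuple (polyV R n d), generates_sgn [set` e]) /\
  (forall (l : nat) (e : l.-tuple (polyV R n d)),
     generates_sgn [set` e] -> (k <= l)%N).

Definition homogeneous f : Prop := exists m : nat, f \is m.-homog.

End PolynomialsOnV.

Arguments inv_polys R n d : clear implicits.
Arguments inv_polys_plus R n d : clear implicits.
Arguments sgn_polys R n d : clear implicits.
Arguments harmonics R n d : clear implicits.
Arguments min_generators_sgn R n d k : clear implicits.

(* Main.v *)
Require Import Defs.
From mathcomp Require Import all_boot all_order all_algebra all_fingroup.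
From mathcomp Require Import classical_sets reals boolp.
From mathcomp Require Import ssrcomplements mpoly.
From mathcomp Require Import ring zify.

(* Let I be the ideal generated by the invariants without constant term.
   For v in R^d put y_j = <v, x_j>. The elementary symmetric functions of y_1, ..., y_n
   lie in I, so modulo I the complete symmetric function h_(n-l+1)(y_1, ..., y_l) equals,
   up to sign, the elementary function e_(n-l+1) of the n - l remaining forms, which is 0.
   Polarizing in v, a product of n - l + 1 coordinates of x_l is congruent modulo I to
   polynomials of lower degree in x_l involving only x_1, ..., x_l; iterating, every
   monomial of degree larger than (n-1) + ... + 0 = 'C(n, 2) lies in I.
   Hence harmonic polynomials have degree at most 'C(n, 2), and orthogonal projection in a
   finite dimensional space writes every polynomial as f = h + w, with h harmonic and w in I.
   For f alternating and homogeneous, alternating this equation expresses f by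
   alternating harmonics and products of invariants with alternating polynomials of
   smaller degree, which gives generation by induction on the degree.
   The Vandermonde determinant in one coordinate has degree 'C(n, 2); it is harmonic because
   an alternating polynomial has no monomial of smaller degree in that coordinate alone.
   Finally, modulo I only the constant term of an invariant coefficient matters, so the
   harmonic parts of any generating family span the alternating harmonics. *)

Set Implicit Arguments.
Unset Strict Implicit.
Unset Printing Implicit Defensive.
Import Order.TTheory GRing.Theory Num.Theory.

Local Open Scope ring_scope.
Local Open Scope classical_set_scope.

(** * Subspaces and ideals as closure properties of predicates *)

Definition is_subspace (R : pzRingType) (V : lmodType R) (W : V -> Prop) :=
  W 0 /\ forall c u v, W u -> W v -> W (c *: u + v).

Section Subspace.
Variables (R : pzRingType) (V : lmodType R) (W : V -> Prop).
Hypothesis Wsub : is_subspace W.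

Lemma subspaceD u v : W u -> W v -> W (u + v).
Proof. by move=> Wu Wv; rewrite -[u]scale1r; apply: Wsub.2. Qed.

Lemma subspaceZ c u : W u -> W (c *: u).
Proof. by move=> Wu; rewrite -[_ *: _]addr0; apply: Wsub.2 Wsub.1. Qed.

Lemma subspaceB u v : W u -> W v -> W (u - v).
Proof.
by move=> Wu Wv; rewrite -scaleN1r; apply: subspaceD => //; apply: subspaceZ.
Qed.

Lemma subspace_sum (I : eqType) (r : seq I) (P : pred I) (F : I -> V) :
  (forall i, i \in r -> P i -> W (F i)) -> W (\sum_(i <- r | P i) F i).
Proof.
move=> WF; rewrite big_seq_cond; apply: big_ind.
- exact: Wsub.1.
- exact: subspaceD.
by move=> i /andP[]; apply: WF.
Qed.

End Subspace.

(** Call the sum $f(s)$. In $f(2s) - 2^m f(s)$ the top term cancels and each lower [w i] is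
    multiplied by [2 ^+ i - 2 ^+ m], which is nonzero; induction on the number of terms gives these,
    and $f(1)$ then gives the top one. *)
Lemma subspace_coef (R : numFieldType) (V : lmodType R) (W : V -> Prop)
    (m : nat) (w : nat -> V) :
    is_subspace W -> (forall s : R, W (\sum_(j < m) s ^+ j *: w j)) ->
  forall j, (j < m)%N -> W (w j).
Proof.
move=> Wsub; elim: m w => [|m IHm] w Ww j //.
have Wlow i : (i < m)%N -> W (w i).
  move=> im; have ne0 : (2 ^+ i - 2 ^+ m : R) != 0.
    by rewrite subr_eq0 lt_eqF // ltr_eXn2l ?ltr1n.
  rewrite -[w i](scalerK ne0); apply: subspaceZ => //.
  apply: (IHm (fun i => (2 ^+ i - 2 ^+ m) *: w i)) => // s.
  have -> : \sum_(j < m) s ^+ j *: ((2 ^+ j - 2 ^+ m) *: w j) =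
      \sum_(j < m.+1) (2 * s) ^+ j *: w j
        - 2 ^+ m *: (\sum_(j < m.+1) s ^+ j *: w j).
    rewrite scaler_sumr -sumrB big_ord_recr /= scalerA exprMn subrr addr0.
    apply: eq_bigr => k _.
    by rewrite !scalerA exprMn mulrBr scalerBl mulrC [in X in _ - X]mulrC.
  by apply: subspaceB => //; apply: subspaceZ.
rewrite ltnS leq_eqVlt => /orP[/eqP->|]; last exact: Wlow.
have := Ww 1; rewrite big_ord_recr /= expr1n scale1r.
under eq_bigr do rewrite expr1n scale1r.
move=> WS; rewrite -[w m](addKr (\sum_(i < m) w i)) addrC.
by apply: subspaceB => //; apply: subspace_sum => // i _ _; apply: Wlow.
Qed.

Definition is_ideal (A : nzRingType) (I : A -> Prop) :=
  [/\ I 0, forall p q, I p -> I q -> I (p + q) & forall a p, I p -> I (a * p)].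

Lemma ideal_subspace (R : nzRingType) (A : lalgType R) (I : A -> Prop) :
  is_ideal I -> is_subspace I.
Proof.
case=> I0 ID IM; split=> // c u v Iu Iv; apply: ID => //.
by rewrite -[u]mul1r scalerAl; apply: IM.
Qed.

(** * Long products of coordinates lie in the ideal *)

Section Nilpotency.
Variables (R : numFieldType) (A : comAlgType R) (n d : nat).
Variable x : 'I_n -> 'I_d -> A.

Definition lform (v : 'I_d -> R) j : A := \sum_c v c *: x j c.

(* (-1)^k times the k-th elementary symmetric function of the forms of index at least i *)
Definition tail_coef v i k : A :=
  (\prod_(j < n | (i <= j)%N) (1 - (lform v j)%:P * 'X))`_k.

(** Split off the factor $1 - y_i X$ and compare coefficients of degree [k.+1]. *)
Lemma tail_coefS v (i : 'I_n) k :
  tail_coef v i.+1 k.+1 = tail_coef v i k.+1 + lform v i * tail_coef v i.+1 k.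
Proof.
have lt_iE (j : 'I_n) : ((i <= j) && (j != i) = (i < j))%N.
  by rewrite andbC eq_sym -ltn_neqAle.
rewrite /tail_coef [in RHS](bigD1 i) //= (eq_bigl _ _ lt_iE).
by rewrite mulrBl mul1r coefB -mulrA coefCM coefXM /= subrK.
Qed.

Lemma tail_coef0 v i : tail_coef v i 0 = 1.
Proof.
rewrite /tail_coef; apply: (big_ind (fun p : {poly A} => p`_0 = 1)).
- by rewrite coef1.
- by move=> p q p1 q1; rewrite coef0M p1 q1 mulr1.
by move=> j _; rewrite coefB coef1 coefMX subr0.
Qed.

(** The product has only [n - i] factors, each of degree at most 1 in ['X]. The induction goes down
    from [i = n]. *)
Lemma tail_coef_eq0 v i k : (i <= n)%N -> (n - i < k)%N -> tail_coef v i k = 0.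
Proof.
move=> /subKn <-; have: (n - i <= n)%N by exact: leq_subr.
elim: (n - i)%N k => [|m IHm] [|k] // mn mk; last first.
  have lt_n : (n - m.+1 < n)%N by rewrite ltn_subrL (leq_trans _ mn).
  have := tail_coefS v (Ordinal lt_n) k; rewrite /= subnSK // => /esym/eqP.
  by rewrite !IHm ?(ltnW mn) ?mulr0 ?addr0 -?subn0; [move/eqP| lia..].
rewrite /tail_coef subn0 big_pred0 ?coef1 // => j.
by rewrite leqNgt ltn_ord.
Qed.

Variable I : A -> Prop.
Hypothesis Iideal : is_ideal I.
Hypothesis Itail : forall v k, I (tail_coef v 0 k.+1).

Definition xprod (J : seq ('I_n * 'I_d)) : A := \prod_(a <- J) x a.1 a.2.

Section OneBlock.
Variables (l : 'I_n) (k0 : nat) (K : A -> Prop).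
Hypothesis Kideal : is_ideal K.
Hypothesis subIK : forall p, I p -> K p.
Hypothesis KJ : forall J, size J = k0 ->
  all (fun a : 'I_n * 'I_d => a.1 <= l)%N J ->
  has (fun a : 'I_n * 'I_d => a.1 < l)%N J -> K (xprod J).

(** By [tail_coefS], either [i] drops, ending at [i = 0] where [Itail] applies, or a coordinate of
    block [i < l] joins [J] while [k] drops, ending at [k = 0] where [KJ] applies. *)
Lemma xprod_tail v i k J : (i <= l)%N -> (size J + k)%N = k0 ->
    all (fun a : 'I_n * 'I_d => a.1 <= l)%N J ->
    (0 < k)%N || has (fun a : 'I_n * 'I_d => a.1 < l)%N J ->
  K (xprod J * tail_coef v i k).
Proof.
have [K0 KD KM] := Kideal.
elim: i k J => [|i IHi] k J il.
  case: k => [|k] /=; last by move=> *; apply/KM/subIK/Itail.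
  by rewrite addn0 tail_coef0 mulr1; apply: KJ.
have lt_in : (i < n)%N by exact: ltn_trans il (ltn_ord l).
elim: k J => [|k IHk] J.
  by rewrite addn0 tail_coef0 mulr1 /=; apply: KJ.
move=> szJ Jl _; have := tail_coefS v (Ordinal lt_in) k => /= ->.
rewrite mulrDr; apply: KD; first by apply: IHi => //; apply: ltnW.
rewrite mulrA mulr_sumr mulr_suml.
apply: (subspace_sum (ideal_subspace Kideal)) => c _ _.
rewrite -scalerAr -scalerAl; apply: (subspaceZ (ideal_subspace Kideal)).
have -> : xprod J * x (Ordinal lt_in) c = xprod ((Ordinal lt_in, c) :: J).
  by rewrite /xprod big_cons mulrC.
by apply: IHk; rewrite /= ?il ?(ltnW il) ?orbT // addSnnS.
Qed.

(** Modulo [K] the first term of [tail_coefS] at [l] vanishes by [xprod_tail], so each step only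
    extracts one more factor [lform v l]. *)
Lemma xprod_tail_pow v k J : (size J + k)%N = k0 ->
    all (fun a : 'I_n * 'I_d => a.1 <= l)%N J ->
  K (xprod J * (tail_coef v l.+1 k - lform v l ^+ k)).
Proof.
have [K0 KD KM] := Kideal.
elim: k J => [|k IHk] J; first by rewrite tail_coef0 expr0 subrr mulr0.
move=> szJ Jl; rewrite tail_coefS exprS -addrA -mulrBr mulrDr.
apply: KD; first exact: xprod_tail.
rewrite mulrA mulr_sumr mulr_suml.
apply: (subspace_sum (ideal_subspace Kideal)) => c _ _.
rewrite -scalerAr -scalerAl; apply: (subspaceZ (ideal_subspace Kideal)).
have -> : xprod J * x l c = xprod ((l, c) :: J).
  by rewrite /xprod big_cons mulrC.
by apply: IHk; rewrite /= ?leqnn // addSnnS.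
Qed.

(** Only [n - l.+1] forms come after block [l], so their coefficient of index [n - l] is 0 and the
    congruence leaves the power alone. *)
Lemma lform_pow v : k0 = (n - l)%N -> K (lform v l ^+ k0).
Proof.
move=> k0E; have [K0 KD KM] := Kideal.
have /(_ isT) := xprod_tail_pow v (k := k0) (J := [::]) (erefl _).
rewrite tail_coef_eq0 ?ltn_ord // ?k0E; last by have := ltn_ord l; lia.
by rewrite sub0r /xprod big_nil mul1r => /(KM (-1)); rewrite mulN1r opprK.
Qed.

(* Polarization: the coefficient of [s] in [(lform v l + s x_lc)^m]. *)
Lemma block_xprod (C : seq 'I_d) : k0 = (n - l)%N -> size C = k0 ->
  K (\prod_(c <- C) x l c).
Proof.
move=> k0E szC; have Ksub := ideal_subspace Kideal.
(* [r] counts the factors of the power already traded for coordinates; [v] stays arbitrary because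
   each trade varies it. *)
suff H r : (r <= k0)%N -> forall C v, size C = r ->
    K (lform v l ^+ (k0 - r) * \prod_(c <- C) x l c).
  by have := H k0 (leqnn _) C (fun=> 0) szC; rewrite subnn mul1r.
elim: r => [|r IHr] rk {szC}C v.
  by move/size0nil->; rewrite subn0 big_nil mulr1; apply: lform_pow.
case: C => // c C [szC]; rewrite big_cons.
set P := \prod_(c <- C) _; set m := (k0 - r.+1)%N.
have k0r : (k0 - r)%N = m.+1 by rewrite /m subnSK.
have ne0 : (m.+1%:R : R) != 0 by rewrite pnatr_eq0.
pose w j := (lform v l ^+ (m.+1 - j) * x l c ^+ j *+ 'C(m.+1, j)) * P.
suff : K (w 1%N).
  move/(subspaceZ Ksub (m.+1%:R)^-1); rewrite /w subSS subn0 bin1 expr1.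
  by rewrite -scaler_nat -scalerAl scalerA mulVf // scale1r -mulrA.
apply: (subspace_coef Ksub (m := m.+2)) => // s.
have := IHr (ltnW rk) C (fun c' => v c' + s * (c' == c)%:R) szC.
rewrite k0r; have -> : lform (fun c' => v c' + s * (c' == c)%:R) l
    = lform v l + s *: x l c.
  rewrite /lform; under eq_bigr do rewrite scalerDl.
  rewrite big_split /=; congr (_ + _); rewrite (bigD1 c) //= eqxx mulr1.
  by rewrite big1 ?addr0 // => c' /negPf->; rewrite mulr0 scale0r.
rewrite exprDn mulr_suml; congr (K _); apply: eq_bigr => j _.
by rewrite exprZn -scalerAr scalerMnr -scalerAl.
Qed.

End OneBlock.

Lemma xprod_cat J1 J2 : xprod (J1 ++ J2) = xprod J1 * xprod J2.
Proof. by rewrite /xprod big_cat. Qed.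

Lemma perm_xprod J1 J2 : perm_eq J1 J2 -> xprod J1 = xprod J2.
Proof. by move=> J12; apply: perm_big. Qed.

(** [n - j.+1] is the largest number of coordinates of block [j] that [block_xprod] cannot reduce,
    so a longer product overfills some block. *)
Lemma xprod_ideal_blocks i J : (i <= n)%N -> all (fun a : 'I_n * 'I_d => a.1 < i)%N J ->
  (\sum_(j < i) (n - j.+1) < size J)%N -> I (xprod J).
Proof.
have [I0 ID IM] := Iideal.
elim: i J => [|i IHi] J lt_in Ji; first by case: J Ji.
rewrite big_ord_recr /=; pose l := Ordinal lt_in.
(* Inner induction on the number of coordinates taken from [l], the last block allowed. *)
have [a] := ubnP (count (fun a : 'I_n * 'I_d => a.1 == l) J).
elim: a J Ji => // a IHa J Ji; rewrite ltnS => Ja szJ.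
pose J1 : seq ('I_n * 'I_d) := [seq a <- J | a.1 != l].
pose J2 : seq ('I_n * 'I_d) := [seq a <- J | a.1 == l].
have EJ : perm_eq J (J2 ++ J1) by rewrite perm_sym perm_filterC.
have J1i : all (fun a : 'I_n * 'I_d => a.1 < i)%N J1.
  apply/allP => b; rewrite mem_filter => /andP[bl /(allP Ji)].
  by rewrite ltnS leq_eqVlt => /orP[bi|//]; case/eqP: bl; apply/val_inj/eqP.
have szE : (size J = size J2 + size J1)%N by rewrite (perm_size EJ) size_cat.
have szJ2 : (size J2 <= a)%N by rewrite size_filter.
rewrite (perm_xprod EJ) xprod_cat.
(* If block [l] contributes at most [n - i.+1] coordinates, the other factors already exceed the
   bound for [i] blocks. *)
have [lt2|le2] := ltnP (size J2) (n - i).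
  apply: IM; apply: IHi => //; first exact: ltnW.
  by move: szJ; rewrite szE; set S := (\sum_(j < i) _)%N; lia.
rewrite -(cat_take_drop (n - i) J2) xprod_cat -mulrA.
set J3 := take _ J2; set J4 := drop _ J2.
have szJ3 : size J3 = (n - i)%N by rewrite size_take_min; lia.
have szJ4 : (size J3 + size J4 = size J2)%N by rewrite -size_cat cat_take_drop.
have J2l : all (fun a : 'I_n * 'I_d => a.1 == l) J2 by apply: filter_all.
have [J3l J4l] : all (fun a : 'I_n * 'I_d => a.1 == l) J3 /\ all (fun a : 'I_n * 'I_d => a.1 == l) J4.
  by apply/andP; rewrite -all_cat cat_take_drop.
(* [K] is the ideal quotient of [I] by the leftover factors. A product as in [KJ] has a coordinate
   below [l], so putting it in place of [J3] lowers the count of block [l]. *)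
pose K q := I (q * (xprod J4 * xprod J1)).
have -> : xprod J3 = \prod_(c <- [seq a.2 | a <- J3]) x l c.
  by rewrite big_map; apply: eq_big_seq => b /(allP J3l)/eqP->.
apply: (@block_xprod l (n - i) K); rewrite ?size_map //.
- split; first by rewrite /K mul0r.
    by move=> p q; rewrite /K mulrDl; apply: ID.
  by move=> b p; rewrite /K -mulrA; apply: IM.
- by move=> p Ip; rewrite /K mulrC; apply: IM.
move=> J' szJ' J'l J'h; rewrite /K -!xprod_cat; apply: IHa.
- rewrite !all_cat (sub_all _ J'l) //=.
  apply/andP; split; last by apply: sub_all J1i => b /ltnW.
  by apply: sub_all J4l => b /eqP->; apply: leqnn.
- have cJ1 : count (fun b : 'I_n * 'I_d => b.1 == l) J1 = 0%N.
    rewrite (@eq_in_count _ _ pred0) ?count_pred0 // => b.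
    by rewrite mem_filter => /andP[/negPf].
  have cJ' : (count (fun b : 'I_n * 'I_d => b.1 == l) J' < size J')%N.
    rewrite -(count_predC (fun b : 'I_n * 'I_d => b.1 == l)) -{1}[count _ _]addn0.
    rewrite ltn_add2l -has_count; apply: sub_has J'h => b /= bl.
    by rewrite neq_ltn bl.
  have := count_size (fun b : 'I_n * 'I_d => b.1 == l) J4.
  by rewrite !count_cat cJ1; lia.
by rewrite !size_cat szJ'; lia.
Qed.

End Nilpotency.

(** * The inner product in the monomial basis *)

Section ApolarInner.
Variables (R : realType) (n d : nat).
Implicit Types (f g h p q : polyV R n d) (m : 'X_{1..(n * d)}) (s : 'S_n).

Lemma meval_at0 f : f.@[fun=> 0] = f@_0%MM.
Proof.
rewrite {1}[f]mpolyE [in RHS](mpolyE f) !raddf_sum /=.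
apply: eq_bigr => m _; rewrite mevalZ mevalX mcoeffZ mcoeffX; congr (_ * _).
have [->|m0] := eqVneq m 0%MM; first by rewrite big1 // => i _; rewrite mnm0E.
have [i mi] : exists i, m i != 0%N.
  apply/existsP; apply: contraNT m0 => /existsPn m0; apply/eqP/mnmP => i.
  by rewrite mnm0E; apply/eqP/negPn.
by rewrite (bigD1 i) //= expr0n (negPf mi) mul0r.
Qed.

(** The squared norm of the monomial ['X_[m]]. *)
Definition mfactorial m : nat := \prod_i (m i)`!.

Lemma mfactorial_gt0 m : 0 < (mfactorial m)%:R :> R.
Proof. by rewrite ltr0n prodn_gt0 // => i; apply: fact_gt0. Qed.

(** At 0, the derivative of [g] along [m] is [g@_m] times [mfactorial m]; in particular distinct
    monomials are orthogonal. *)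
Lemma innerE f g :
  inner f g = \sum_(m <- msupp f) f@_m * g@_m * (mfactorial m)%:R.
Proof.
rewrite /inner meval_at0 /diffop raddf_sum /=; apply: eq_bigr => m _.
rewrite mcoeffZ mcoeff_mderivm addm0 -mulrA mulr_natr; congr (_ * (_ *+ _)).
by apply: eq_bigr => i _; rewrite ffactnn.
Qed.

(** An index set that does not depend on [f] lets symmetry and linearity be checked term by term. *)
Lemma innerwE k f g : (msize f <= k)%N ->
  inner f g = \sum_(m : 'X_{1..(n * d) < k}) f@_m * g@_m * (mfactorial m)%:R.
Proof.
move=> fk; rewrite innerE (big_mksub 'X_{1..(n * d) < k}) /= ?msupp_uniq //.
  by rewrite big_rmcond // => m /memN_msupp_eq0->; rewrite !mul0r.
by move=> m /msize_mdeg_lt /leq_trans; apply.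
Qed.

Lemma innerC f g : inner f g = inner g f.
Proof.
rewrite (innerwE (k := maxn (msize f) (msize g))) ?leq_maxl //.
rewrite (innerwE (k := maxn (msize f) (msize g))) ?leq_maxr //.
by apply: eq_bigr => m _; rewrite [f@_m * _]mulrC.
Qed.

Lemma inner_linearl c p q g : inner (c *: p + q) g = c * inner p g + inner q g.
Proof.
pose k := maxn (msize (c *: p + q)) (maxn (msize p) (msize q)).
rewrite !(innerwE (k := k)) ?leq_max ?leqnn ?orbT // mulr_sumr -big_split /=.
by apply: eq_bigr => m _; rewrite mcoeffD mcoeffZ; ring.
Qed.

Lemma inner_linearr c p q f : inner f (c *: p + q) = c * inner f p + inner f q.
Proof. by rewrite innerC inner_linearl !(innerC f). Qed.

Lemma inner0l g : inner 0 g = 0.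
Proof. by rewrite innerE msupp0 big_nil. Qed.

Lemma innerDl p q g : inner (p + q) g = inner p g + inner q g.
Proof. by rewrite -[p]scale1r inner_linearl mul1r scale1r. Qed.

Lemma innerZl c p g : inner (c *: p) g = c * inner p g.
Proof. by rewrite -[_ *: _]addr0 inner_linearl inner0l addr0. Qed.

Lemma inner_suml (I : Type) (r : seq I) (P : pred I) (F : I -> polyV R n d) g :
  inner (\sum_(i <- r | P i) F i) g = \sum_(i <- r | P i) inner (F i) g.
Proof.
by apply: (big_morph (fun f => inner f g)) => [p q|];
  rewrite ?innerDl ?inner0l.
Qed.

Lemma innerX m g : inner 'X_[m] g = g@_m * (mfactorial m)%:R.
Proof. by rewrite innerE msuppX big_seq1 mcoeffX eqxx mul1r. Qed.

(** The norm is a sum of squares with positive weights. *)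
Lemma inner_eq0 f : inner f f = 0 -> f = 0.
Proof.
have term_ge0 m : 0 <= f@_m * f@_m * (mfactorial m)%:R.
  by apply: mulr_ge0; [rewrite -expr2 sqr_ge0|apply/ltW/mfactorial_gt0].
rewrite (innerwE (k := msize f)) // => /eqP; rewrite psumr_eq0 // => /allP f0.
apply/mpolyP => m; rewrite mcoeff0.
have [mf|] := boolP (m \in msupp f); last exact: memN_msupp_eq0.
have := f0 (BMultinom (msize_mdeg_lt mf)) (mem_index_enum _).
by rewrite /= !mulf_eq0 orbb (gt_eqF (mfactorial_gt0 m)) orbF => /eqP.
Qed.

Lemma mcoeff_pihomog e f m :
  (pihomog mdeg e f)@_m = if mdeg m == e then f@_m else 0.
Proof.
rewrite pihomogE raddf_sum big_mkcond [f in RHS]mpolyE raddf_sum /=.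
have [me|me] := eqVneq (mdeg m) e; last first.
  apply: big1 => m' _; case: eqP => // m'e; rewrite mcoeffZ mcoeffX.
  by have /negPf-> : m' != m; [apply: contra_neq me => <-|rewrite mulr0].
apply: eq_bigr => m' _; case: eqP => // m'e; rewrite mcoeffZ mcoeffX.
by have /negPf-> : m' != m; [apply: contra_not_neq m'e => ->|rewrite mulr0].
Qed.

Lemma inner_pihomog e f g : inner (pihomog mdeg e f) g = inner f (pihomog mdeg e g).
Proof.
pose k := maxn (msize f) (msize (pihomog mdeg e f)).
rewrite !(innerwE (k := k)) ?leq_max ?leqnn ?orbT //.
by apply: eq_bigr => m _; rewrite !mcoeff_pihomog; case: ifP; rewrite ?(mulr0, mul0r).
Qed.

End ApolarInner.

(** * The permutation action on polynomials *)

Section Action.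
Variables (R : realType) (n d : nat).
Implicit Types (f g h p q : polyV R n d) (m : 'X_{1..(n * d)}) (s t : 'S_n).

Definition xvar (i : 'I_n) (j : 'I_d) : polyV R n d := 'X_(mxvec_index i j).

Definition block_fun s (k : 'I_(n * d)) : 'I_(n * d) :=
  let: isMxvecIndex i j := mxvec_indexP k in mxvec_index (s i) j.

Lemma mxvec_index_inj (i i' : 'I_n) (j j' : 'I_d) :
  mxvec_index i j = mxvec_index i' j' -> i = i' /\ j = j'.
Proof.
by move=> /cast_ord_inj/enum_rank_inj[-> ->].
Qed.

Lemma block_funE s i j : block_fun s (mxvec_index i j) = mxvec_index (s i) j.
Proof.
rewrite /block_fun; move E: (mxvec_index i j) => k.
by case: k / (mxvec_indexP k) E => i' j' /mxvec_index_inj[-> ->].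
Qed.

Lemma block_fun_inj s : injective (block_fun s).
Proof.
move=> k k'; case/mxvec_indexP: k => i j; case/mxvec_indexP: k' => i' j'.
by rewrite !block_funE => /mxvec_index_inj[/perm_inj-> ->].
Qed.

Definition block_perm s : 'S_(n * d) := perm (@block_fun_inj s).

Lemma block_permE s i j : block_perm s (mxvec_index i j) = mxvec_index (s i) j.
Proof. by rewrite permE block_funE. Qed.

Lemma block_permM s t : block_perm (s * t)%g = (block_perm s * block_perm t)%g.
Proof.
by apply/permP => k; case/mxvec_indexP: k => i j; rewrite permM !block_permE permM.
Qed.

Lemma block_perm1 : block_perm 1%g = 1%g.
Proof. by apply/permP => k; case/mxvec_indexP: k => i j; rewrite block_permE !perm1. Qed.

Lemma block_permV s : block_perm s^-1 = (block_perm s)^-1%g.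
Proof. by apply/esym/eqP; rewrite eq_invg_mul -block_permM mulgV block_perm1. Qed.

(** Turns the substitution into the renaming of variables [msym], from which linearity,
    multiplicativity and compatibility with degrees are inherited. *)
Lemma act_permE s f : act_perm s f = msym (block_perm s^-1) f.
Proof.
rewrite -[RHS]comp_mpoly_id msym_mPo; congr (_ \mPo _).
apply/eq_mktuple => k; rewrite tnth_mktuple; case/mxvec_indexP: k => i j.
by rewrite mxvecE block_permE !mxE.
Qed.

Lemma act_perm_linear s c p q :
  act_perm s (c *: p + q) = c *: act_perm s p + act_perm s q.
Proof. by rewrite !act_permE linearP. Qed.

Lemma act_permD s p q : act_perm s (p + q) = act_perm s p + act_perm s q.
Proof. by rewrite !act_permE raddfD. Qed.

Lemma act_permZ s c p : act_perm s (c *: p) = c *: act_perm s p.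
Proof. by rewrite !act_permE linearZ. Qed.

Lemma act_perm0 s : act_perm s (0 : polyV R n d) = 0.
Proof. by rewrite act_permE raddf0. Qed.

Lemma act_perm_prod s p q : act_perm s (p * q) = act_perm s p * act_perm s q.
Proof. by rewrite !act_permE rmorphM. Qed.

Lemma act_perm_sum s (I : Type) (r : seq I) (P : pred I) (F : I -> polyV R n d) :
  act_perm s (\sum_(i <- r | P i) F i) = \sum_(i <- r | P i) act_perm s (F i).
Proof. by rewrite act_permE raddf_sum; apply: eq_bigr => i _; rewrite act_permE. Qed.

Lemma act_permM s t f : act_perm (s * t)%g f = act_perm s (act_perm t f).
Proof. by rewrite !act_permE invMg block_permM msymMm. Qed.

Lemma act_perm1 f : act_perm 1%g f = f.
Proof. by rewrite act_permE invg1 block_perm1 msym1m. Qed.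

Lemma act_perm_xvar s i j : act_perm s (xvar i j) = xvar (s^-1%g i) j.
Proof.
rewrite act_permE msymX; congr 'X_[_]; apply/mnmP => k.
rewrite mnmE !mnm1E -block_permE.
by rewrite -(inj_eq (@perm_inj _ (block_perm s^-1))) permKV.
Qed.

Lemma mcoeff_act_perm s f m :
  (act_perm s f)@_m = f@_[multinom m (block_perm s^-1%g k) | k < n * d].
Proof. by rewrite act_permE mcoeff_sym. Qed.

Lemma act_perm_pihomog s e f :
  act_perm s (pihomog mdeg e f) = pihomog mdeg e (act_perm s f).
Proof. by rewrite !act_permE msym_pihomog. Qed.

(** The action permutes the monomials and preserves [mfactorial], hence is orthogonal. *)
Lemma inner_act_perm s f g : inner (act_perm s f) g = inner f (act_perm s^-1%g g).
Proof.
rewrite [f]mpolyE act_perm_sum !inner_suml; apply: eq_bigr => m _.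
rewrite act_permZ !innerZl innerX mcoeff_act_perm act_permE msymX innerX.
rewrite -block_permV !invgK; congr (_ * (_ * _%:R)).
rewrite /mfactorial [RHS](reindex_inj (@perm_inj _ (block_perm s))).
by apply: eq_bigr => k _; rewrite mnmE.
Qed.

End Action.

(** * The ideal of invariants without constant term, and the harmonics *)

Section CoinvariantIdeal.
Variables (R : realType) (n d : nat).
Implicit Types (f g h p q : polyV R n d) (m : 'X_{1..(n * d)}) (s t : 'S_n).
Implicit Types (W : set (polyV R n d)).

Lemma sumprod0 W W' : sumprod W W' 0.
Proof. by exists [::]; rewrite big_nil. Qed.

Lemma sumprodD W W' p q : sumprod W W' p -> sumprod W W' q -> sumprod W W' (p + q).
Proof.
move=> [l1 [W1 ->]] [l2 [W2 ->]]; exists (l1 ++ l2); rewrite big_cat; split=> // ab.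
by rewrite mem_cat => /orP[/W1|/W2].
Qed.

Lemma sumprod_mul W W' p q : W p -> W' q -> sumprod W W' (p * q).
Proof.
by move=> Wp Wq; exists [:: (p, q)]; rewrite big_seq1; split=> // ab /[!inE] /eqP->.
Qed.

Lemma sumprod_sum W W' (I : eqType) (r : seq I) (P : pred I) (F : I -> polyV R n d) :
  (forall i, i \in r -> P i -> sumprod W W' (F i)) ->
  sumprod W W' (\sum_(i <- r | P i) F i).
Proof.
move=> WF; rewrite big_seq_cond; apply: big_ind.
- exact: sumprod0.
- exact: sumprodD.
by move=> i /andP[]; apply: WF.
Qed.

Definition coinv_ideal := sumprod [set: polyV R n d] (inv_polys_plus R n d).

Lemma coinv_idealP : is_ideal coinv_ideal.
Proof.
split; [exact: sumprod0|by move=> p q; apply: sumprodD|].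
move=> a p [l [Wl ->]]; rewrite mulr_sumr; apply: sumprod_sum => u /Wl[_ Wu] _.
by rewrite mulrA; apply: sumprod_mul.
Qed.

Lemma coinv_ideal_inv p : inv_polys_plus R n d p -> coinv_ideal p.
Proof. by move=> Wp; rewrite -[p]mul1r; apply: sumprod_mul. Qed.

Lemma inv_polys_plusE p : inv_polys_plus R n d p <-> inv_polys R n d p /\ p@_0%MM = 0.
Proof. by rewrite -meval_at0. Qed.

(** A permutation of the blocks permutes the factors of the product. Taking constant terms turns
    every factor into 1, so only the coefficient of index 0 survives. *)
Lemma xvar_tail_coef v k :
  inv_polys_plus R n d (tail_coef (@xvar R n d) v 0 k.+1).
Proof.
apply/inv_polys_plusE; split=> [s|]; last first.
  rewrite /tail_coef -(coef_map (mcoeff 0%MM)) rmorph_prod /= big1 ?coef1 // => j _.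
  rewrite rmorphB rmorph1 rmorphM /= map_polyC map_polyX /= /lform raddf_sum /=.
  rewrite big1 ?mul0r ?subr0 // => c _.
  rewrite mcoeffZ mcoeffX; have /negPf-> : U_(mxvec_index j c)%MM != 0%MM :> 'X_{1..(n * d)}.
    by rewrite -mdeg_eq0 mdeg1.
  by rewrite mulr0.
have act_lform j : act_perm s (lform (@xvar R n d) v j) = lform (@xvar R n d) v (s^-1%g j).
  by rewrite act_perm_sum; apply: eq_bigr => c _; rewrite act_permZ act_perm_xvar.
rewrite act_permE /tail_coef -(coef_map (msym (block_perm d s^-1))) rmorph_prod /=.
rewrite [in RHS](reindex_inj (@perm_inj _ s^-1%g)) /=.
congr (nth 0 (polyseq _) _); apply: eq_big => // j _.
by rewrite rmorphB rmorph1 rmorphM /= map_polyC map_polyX /= -act_permE act_lform.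
Qed.

Lemma mpolyX_xprod m : exists2 J, size J = mdeg m & 'X_[m] = xprod (@xvar R n d) J.
Proof.
rewrite mdegE mpolyXE_id.
apply: (big_ind2 (fun k p => exists2 J, size J = k & p = xprod (@xvar R n d) J)).
- by exists [::]; rewrite /xprod ?big_nil.
- move=> k1 p1 k2 p2 [J1 <- ->] [J2 <- ->]; exists (J1 ++ J2); first by rewrite size_cat.
  by rewrite xprod_cat.
move=> k _; case/mxvec_indexP: k => i j; exists (nseq (m (mxvec_index i j)) (i, j)).
  by rewrite size_nseq.
by rewrite /xprod big_nseq -Monoid.iteropE.
Qed.

Lemma sum_triangle : (\sum_(j < n) (n - j.+1) = 'C(n, 2))%N.
Proof.
rewrite (reindex_inj rev_ord_inj) /= -bin2_sum big_mkord.
by apply: eq_bigr => j _; have := ltn_ord j; lia.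
Qed.

Lemma coinv_ideal_mpolyX m : ('C(n, 2) < mdeg m)%N -> coinv_ideal 'X_[m].
Proof.
move=> ltm; have [J szJ ->] := mpolyX_xprod m.
apply: (xprod_ideal_blocks coinv_idealP) (leqnn n) _ _ => [v k||].
- exact/coinv_ideal_inv/xvar_tail_coef.
- by apply/allP => a _; apply: ltn_ord.
by rewrite sum_triangle szJ.
Qed.

Lemma coinv_ideal_high p :
  (forall m, (mdeg m <= 'C(n, 2))%N -> p@_m = 0) -> coinv_ideal p.
Proof.
move=> p0; have [I0 _ _] := coinv_idealP; have Isub := ideal_subspace coinv_idealP.
rewrite [p]mpolyE; apply: (subspace_sum Isub) => m _ _.
have [/p0->|ltm] := leqP (mdeg m) 'C(n, 2); first by rewrite scale0r.
by apply: (subspaceZ Isub); apply: coinv_ideal_mpolyX.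
Qed.

Lemma harmonics_msize h : harmonics R n d h -> (msize h <= 'C(n, 2).+1)%N.
Proof.
move=> Hh; rewrite msizeE; apply/bigmax_leqP_seq => m mh _; rewrite ltnS leqNgt.
apply: contraL mh => /coinv_ideal_mpolyX/Hh; rewrite innerX => /eqP.
by rewrite mulf_eq0 (gt_eqF (mfactorial_gt0 R m)) orbF mcoeff_eq0.
Qed.

Lemma harmonics_subspace : is_subspace (harmonics R n d).
Proof.
split=> [p _|c p q Hp Hq w Iw]; first by rewrite innerC inner0l.
by rewrite inner_linearr Hp // Hq // mulr0 addr0.
Qed.

Lemma sgn_polys_subspace : is_subspace (sgn_polys R n d).
Proof.
split=> [s|c p q Sp Sq s]; first by rewrite act_perm0 scaler0.
by rewrite act_perm_linear Sp Sq scalerDr !scalerA mulrC.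
Qed.

Lemma inv_polys_subspace : is_subspace (inv_polys R n d).
Proof.
by split=> [s|c p q Ip Iq s]; rewrite ?act_perm0 // act_perm_linear Ip Iq.
Qed.

Lemma harmonics_coinv0 p : harmonics R n d p -> coinv_ideal p -> p = 0.
Proof. by move=> Hp Ip; apply/inner_eq0/Hp. Qed.

Lemma inv_polys_mul p q : inv_polys R n d p -> inv_polys R n d q -> inv_polys R n d (p * q).
Proof. by move=> Ip Iq s; rewrite act_perm_prod Ip Iq. Qed.

Lemma inv_polys1 : inv_polys R n d 1.
Proof. by move=> s; rewrite act_permE rmorph1. Qed.

Lemma coinv_ideal_act s p : coinv_ideal p -> coinv_ideal (act_perm s p).
Proof.
move=> [l [Wl ->]]; rewrite act_perm_sum; apply: sumprod_sum => u /Wl[_ Wu] _.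
rewrite act_perm_prod; apply: sumprod_mul => //.
by have [Iu _] := Wu; rewrite Iu.
Qed.

Lemma harmonics_act s h : harmonics R n d h -> harmonics R n d (act_perm s h).
Proof.
by move=> Hh p /(coinv_ideal_act s^-1)/Hh; rewrite inner_act_perm invgK.
Qed.

Lemma pihomogM e p q : pihomog mdeg e (p * q) =
  \sum_(i < e.+1) pihomog mdeg i p * pihomog mdeg (e - i) q.
Proof.
pose k := maxn e.+1 (maxn (msize p) (msize q)).
have [ek pk qk] : [/\ e < k, msize p <= k & msize q <= k]%N.
  by rewrite !leq_max !leqnn !orbT.
rewrite {1}[p](pihomog_partitionE (mf := mdeg) pk) {1}[q](pihomog_partitionE (mf := mdeg) qk).
rewrite mulr_suml raddf_sum /=.
rewrite (big_ord_widen k (fun i => pihomog mdeg i p * pihomog mdeg (e - i) q)) //.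
rewrite [RHS]big_mkcond /=; apply: eq_bigr => i _; rewrite mulr_sumr raddf_sum /=.
have hom j : pihomog mdeg i p * pihomog mdeg j q \is (i + j).-homog.
  by apply: dhomogM; apply: pihomogP.
have [ie|ei] := ltnP i e.+1; last first.
  by rewrite big1 // => j _; apply: pihomog_ne0 (hom j); lia.
have lt_k : (e - i < k)%N by apply: leq_ltn_trans ek; apply: leq_subr.
rewrite (bigD1 (Ordinal lt_k)) //= big1 => [|j /eqP ne]; last first.
  apply: pihomog_ne0 (hom j); apply/eqP => E; apply: ne; apply: val_inj => /=.
  by rewrite -E addKn.
by rewrite addr0 pihomog_dE //; have := hom (e - i)%N; rewrite subnKC.
Qed.

Lemma inv_polys_plus_pihomog e p :
  inv_polys_plus R n d p -> inv_polys_plus R n d (pihomog mdeg e p).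
Proof.
move=> /inv_polys_plusE[Ip p0]; apply/inv_polys_plusE; split=> [s|].
  by rewrite act_perm_pihomog Ip.
by rewrite mcoeff_pihomog p0 if_same.
Qed.

(** Besides homogeneity of the ideal, this records that the cofactors have degree below [e], on
    which the induction for generation rests. *)
Lemma coinv_ideal_pihomog e p : coinv_ideal p -> exists l : seq (polyV R n d * polyV R n d),
  [/\ forall ab, ab \in l -> inv_polys_plus R n d ab.2 /\
        exists2 i, (i < e)%N & ab.1 \is i.-homog
    & pihomog mdeg e p = \sum_(ab <- l) ab.1 * ab.2].
Proof.
move=> [l [Wl ->]].
exists [seq (pihomog mdeg i ab.1, pihomog mdeg (e - i) ab.2) | ab <- l, i <- iota 0 e].
split=> [ab|].
  case/allpairsP=> -[ab' i] /= [/Wl[_ Wab] /[!mem_iota] ie ->] /=.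
  by split; [apply: inv_polys_plus_pihomog|exists i => //; apply: pihomogP].
rewrite big_allpairs_dep /= raddf_sum /= big_seq_cond [RHS]big_seq_cond.
apply: eq_bigr => ab /andP[/Wl[_ /inv_polys_plusE[_ ab0]] _].
(* The term with cofactor of degree [e] carries the constant term of the invariant, which is 0. *)
rewrite pihomogM big_ord_recr /= subnn [pihomog _ 0 _](_ : _ = 0) ?mulr0 ?addr0.
  by rewrite -[e in iota 0 e]subn0 -/(index_iota 0 e) big_mkord.
apply/mpolyP => m; rewrite mcoeff_pihomog mcoeff0 mdeg_eq0.
by case: eqP => // ->.
Qed.

(** [pihomog] is self-adjoint and preserves the ideal. *)
Lemma harmonics_pihomog e h : harmonics R n d h -> harmonics R n d (pihomog mdeg e h).
Proof.
move=> Hh p /(coinv_ideal_pihomog e)[l [Wl E]].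
rewrite -inner_pihomog E; apply: Hh; apply: sumprod_sum => ab /Wl[Wab _] _.
exact: sumprod_mul.
Qed.

Lemma sgn_polys_pihomog e p : sgn_polys R n d p -> sgn_polys R n d (pihomog mdeg e p).
Proof. by move=> Sp s; rewrite act_perm_pihomog Sp linearZ. Qed.

End CoinvariantIdeal.

(** * Free families and spans in a space of arbitrary dimension *)

Section FreeFamilies.
Variables (F : fieldType) (V : lmodType F).
Implicit Types (X : V -> Prop).

Definition in_span k (g : 'I_k -> V) v := exists c : 'I_k -> F, v = \sum_i c i *: g i.

Definition lin_free k (g : 'I_k -> V) :=
  forall c : 'I_k -> F, \sum_i c i *: g i = 0 -> forall i, c i = 0.

Lemma in_span_subspace k (g : 'I_k -> V) : is_subspace (in_span g).
Proof.
split=> [|a u v [cu ->] [cv ->]].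
  by exists (fun=> 0); rewrite big1 // => i _; rewrite scale0r.
exists (fun i => a * cu i + cv i); rewrite scaler_sumr -big_split.
by apply: eq_bigr => i _; rewrite scalerDl scalerA.
Qed.

Lemma in_span_gen k (g : 'I_k -> V) i : in_span g (g i).
Proof.
exists (fun j => (j == i)%:R); rewrite (bigD1 i) //= eqxx scale1r big1 ?addr0 // => j.
by move=> /negPf->; rewrite scale0r.
Qed.

(** The coefficients of [e] in terms of [g] form a matrix with independent rows, whose rank is at
    most its number of columns. *)
Lemma lin_free_leq k l (e : 'I_k -> V) (g : 'I_l -> V) :
  lin_free e -> (forall i, in_span g (e i)) -> (k <= l)%N.
Proof.
move=> free_e /fin_all_exists[C eC]; pose M : 'M[F]_(k, l) := \matrix_(i, j) C i j.
suff /eqP <- : row_free M by apply: rank_leq_col.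
apply: inj_row_free => u uM0; apply/rowP => i; rewrite mxE.
apply: (free_e (fun i => u 0 i)); under eq_bigr do rewrite eC scaler_sumr.
rewrite exchange_big /= big1 // => j _.
under eq_bigr do rewrite scalerA.
have uMj : \sum_i u 0 i * C i j = 0.
  transitivity ((u *m M) 0 j); last by rewrite uM0 mxE.
  by rewrite mxE; apply: eq_bigr => i' _; rewrite mxE.
by rewrite -scaler_suml uMj scale0r.
Qed.

(** Take a free family of maximal size: a vector of [X] outside its span could be added to it. [X]
    is any predicate, so the family can be sought among homogeneous elements. *)
Lemma max_lin_free X D :
    (forall k (e : k.-tuple V), (forall i, X (tnth e i)) -> lin_free (tnth e) ->
       (k <= D)%N) ->
  exists k (e : k.-tuple V), [/\ forall i, X (tnth e i), lin_free (tnth e)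
    & forall v, X v -> in_span (tnth e) v].
Proof.
move=> leD.
pose P k := `[< exists e : k.-tuple V, (forall i, X (tnth e i)) /\ lin_free (tnth e) >].
have exP : exists k, P k.
  by exists 0%N; apply/asboolP; exists [tuple]; split=> [[]|c _ []].
have leP k : P k -> (k <= D)%N by move=> /asboolP[e [Xe /leD]]; apply.
have [k /asboolP[e [Xe free_e]] maxk] := ex_maxnP exP leP.
exists k, e; split=> // v Xv; apply: contrapT => nspan.
suff /maxk : P k.+1 by rewrite ltnn.
apply/asboolP; exists [tuple of v :: e]; split=> [i|c].
  by case: (unliftP ord0 i) => [j|] ->; rewrite ?tnthS ?tnth0.
rewrite big_ord_recl tnth0; under eq_bigr do rewrite tnthS.
have [c0|c0 E] := eqVneq (c ord0) 0.
  rewrite c0 scale0r add0r => /free_e cS i.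
  by case: (unliftP ord0 i) => [j|] ->.
case: nspan; exists (fun i => - (c ord0)^-1 * c (lift ord0 i)).
apply: (scalerI c0); rewrite scaler_sumr.
under eq_bigr do rewrite scalerA mulrA mulrN mulfV // mulN1r scaleNr.
by rewrite sumrN; apply/eqP; rewrite -addr_eq0 E.
Qed.

End FreeFamilies.

(** * Decomposition into a harmonic part and a part in the ideal *)

Section Decomposition.
Variables (R : realType) (n d : nat).
Implicit Types (f g h p q : polyV R n d) (m : 'X_{1..(n * d)}) (s t : 'S_n).

Lemma msize_lin_free_leq K k (e : k.-tuple (polyV R n d)) :
    (forall i, (msize (tnth e i) <= K)%N) -> lin_free (tnth e) ->
  (k <= #|{: 'X_{1..(n * d) < K}}|)%N.
Proof.
move=> szK free_e.
pose mon (j : 'I_#|{: 'X_{1..(n * d) < K}}|) : 'X_{1..(n * d)} :=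
  val (enum_val j : 'X_{1..(n * d) < K}).
apply: (lin_free_leq (g := fun j => 'X_[mon j]) free_e) => i.
exists (fun j => (tnth e i)@_(mon j)).
rewrite {1}[tnth e i](mpolywE (szK i)).
by rewrite (reindex_onto enum_val enum_rank) => [|m _]; rewrite ?enum_rankK //;
  apply: eq_bigl => j; rewrite enum_valK eqxx.
Qed.

(** Truncation at degree ['C(n, 2)], which does not change the class modulo the ideal. *)
Definition low_part p := \sum_(i < 'C(n, 2).+1) pihomog mdeg i p.

Lemma low_part_id p : (msize p <= 'C(n, 2).+1)%N -> low_part p = p.
Proof. by move=> szp; rewrite /low_part -pihomog_partitionE. Qed.

Lemma mcoeff_low_part p m :
  (low_part p)@_m = if (mdeg m <= 'C(n, 2))%N then p@_m else 0.
Proof.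
rewrite raddf_sum /=; under eq_bigr do rewrite mcoeff_pihomog.
rewrite -big_mkcond -ltnS; case: ltnP => lt_m.
  by rewrite (eq_bigl (pred1 (Ordinal lt_m))) ?big_pred1_eq.
by rewrite big_pred0 // => i; apply/negbTE; rewrite gtn_eqF // (leq_trans _ lt_m).
Qed.

Lemma msize_low_part p : (msize (low_part p) <= 'C(n, 2).+1)%N.
Proof.
rewrite msizeE; apply/bigmax_leqP_seq => m + _.
by rewrite mcoeff_msupp mcoeff_low_part ltnS; case: ifP => //; rewrite eqxx.
Qed.

Lemma coinv_low_part p : coinv_ideal (p - low_part p).
Proof.
by apply: coinv_ideal_high => m lem; rewrite mcoeffB mcoeff_low_part lem subrr.
Qed.

Lemma inner_low_part p q : inner (low_part p) q = inner p (low_part q).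
Proof.
rewrite inner_suml innerC inner_suml.
by apply: eq_bigr => i _; rewrite inner_pihomog innerC.
Qed.

Lemma harmonic_decomposition f :
  exists2 h, harmonics R n d h & coinv_ideal (f - h).
Proof.
have Isub := ideal_subspace (@coinv_idealP R n d).
(* The degree bound makes this part of the ideal finite dimensional. *)
pose X p := coinv_ideal p /\ (msize p <= 'C(n, 2).+1)%N.
have [k [e [Xe free_e span_e]]] := max_lin_free (X := X)
  (fun k e Xe => msize_lin_free_leq (fun i => (Xe i).2)).
pose G : 'M[R]_k := \matrix_(i, j) inner (tnth e i) (tnth e j).
(* The Gram matrix of a free family is invertible: a combination orthogonal to the family is
   orthogonal to itself. *)
have Gunit : G \in unitmx.
  rewrite -row_free_unit; apply: inj_row_free => u uG0.
  pose w := \sum_i u 0 i *: tnth e i.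
  have we j : inner w (tnth e j) = 0.
    transitivity ((u *m G) 0 j); last by rewrite uG0 mxE.
    by rewrite mxE inner_suml; apply: eq_bigr => i _; rewrite innerZl mxE.
  have w0 : w = 0.
    apply: inner_eq0; rewrite {1}/w inner_suml big1 // => i _.
    by rewrite innerZl innerC we mulr0.
  by apply/rowP => i; rewrite mxE; apply: (free_e (fun i => u 0 i)).
(* [c] solves the normal equations, so [w] is the orthogonal projection of [low_part f] onto the
   span of [e]. *)
pose b := \row_j inner (low_part f) (tnth e j); pose c := b *m invmx G.
pose w := \sum_i c 0 i *: tnth e i.
have Iw : coinv_ideal w.
  by apply: (subspace_sum Isub) => i _ _; apply: (subspaceZ Isub); case: (Xe i).
have we j : inner w (tnth e j) = inner (low_part f) (tnth e j).
  transitivity ((c *m G) 0 j); last by rewrite mulmxKV // mxE.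
  rewrite [RHS]mxE inner_suml.
  by apply: eq_bigr => i _; rewrite innerZl [G _ _]mxE.
exists (low_part f - w); last first.
  by rewrite opprB addrCA; apply: (subspaceD Isub) => //; exact: coinv_low_part.
move=> p Ip; have szh : (msize (low_part f - w) <= 'C(n, 2).+1)%N.
  have [_] : is_subspace (fun q : polyV R n d => msize q <= 'C(n, 2).+1)%N.
    split=> [|a q r szq szr]; first by rewrite msize0.
    by apply: leq_trans (msizeD_le _ _) _; rewrite geq_max szr (leq_trans (msizeZ_le _ _)).
  move=> /(_ (-1) w (low_part f)); rewrite scaleN1r addrC; apply.
    apply: leq_trans (msize_sum _ _ _) _; apply/bigmax_leqP => i _.
    by apply: leq_trans (msizeZ_le _ _) _; case: (Xe i).
  exact: msize_low_part.
(* The candidate equals its own truncation and truncation is self-adjoint, so testing against [p]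
   amounts to testing against [low_part p], which is in the span of [e]. *)
have [|a lowpE] := span_e (low_part p).
  split; last exact: msize_low_part.
  rewrite -[low_part p](subKr p); apply: (subspaceB Isub) => //.
  exact: coinv_low_part.
rewrite -(low_part_id szh) -inner_low_part lowpE inner_suml big1 // => i _.
rewrite innerZl innerC -[_ - w]addrC -scaleN1r inner_linearl we mulN1r addNr.
by rewrite mulr0.
Qed.

End Decomposition.

(** * Antisymmetrization and generation by alternating harmonics *)

Section Alternation.
Variables (R : realType) (n d : nat).
Implicit Types (f g h p q : polyV R n d) (m : 'X_{1..(n * d)}) (s t : 'S_n).

Definition alt p : polyV R n d :=
  (#|{perm 'I_n}|%:R)^-1 *: \sum_(s : 'S_n) (-1) ^+ s *: act_perm s p.

Lemma card_Sn_neq0 : #|{perm 'I_n}|%:R != 0 :> R.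
Proof. by rewrite pnatr_eq0 -lt0n; apply/card_gt0P; exists 1%g. Qed.

Lemma altD p q : alt (p + q) = alt p + alt q.
Proof.
rewrite /alt -scalerDr -big_split /=; congr (_ *: _); apply: eq_bigr => s _.
by rewrite act_permD scalerDr.
Qed.

Lemma alt0 : alt 0 = 0.
Proof. by rewrite /alt big1 ?scaler0 // => s _; rewrite act_perm0 scaler0. Qed.

Lemma alt_sum (I : Type) (r : seq I) (P : pred I) (F : I -> polyV R n d) :
  alt (\sum_(i <- r | P i) F i) = \sum_(i <- r | P i) alt (F i).
Proof. exact: (big_morph alt altD alt0). Qed.

Lemma alt_sgn p : sgn_polys R n d (alt p).
Proof.
move=> t; rewrite act_permZ act_perm_sum [RHS]scalerA mulrC -scalerA; congr (_ *: _).
rewrite scaler_sumr [RHS](reindex_inj (mulgI t)) /=; apply: eq_bigr => s _.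
by rewrite act_permZ -act_permM odd_permM signr_addb scalerA mulrA -signr_addb addbb mul1r.
Qed.

Lemma alt_id p : sgn_polys R n d p -> alt p = p.
Proof.
move=> Sp; rewrite /alt (eq_bigr (fun=> p)) => [|s _].
  by rewrite sumr_const -scaler_nat scalerA mulVf ?card_Sn_neq0 ?scale1r.
by rewrite Sp scalerA -signr_addb addbb scale1r.
Qed.

Lemma alt_mulr p q : inv_polys R n d q -> alt (p * q) = alt p * q.
Proof.
move=> Iq; rewrite /alt -scalerAl mulr_suml; congr (_ *: _); apply: eq_bigr => s _.
by rewrite act_perm_prod Iq scalerAl.
Qed.

Lemma alt_homog e p : p \is e.-homog -> alt p \is e.-homog.
Proof.
move=> hom_p; apply: rpredZ; apply: rpred_sum => s _; apply: rpredZ.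
by rewrite homog_piE -act_perm_pihomog pihomog_dE.
Qed.

Lemma alt_harmonics h : harmonics R n d h -> harmonics R n d (alt h).
Proof.
move=> Hh; have Hsub := @harmonics_subspace R n d.
apply: (subspaceZ Hsub); apply: (subspace_sum Hsub) => s _ _.
exact/(subspaceZ Hsub)/harmonics_act.
Qed.

(** The action is orthogonal, and a permutation and its inverse have the same sign. *)
Lemma inner_alt p q : inner (alt p) q = inner p (alt q).
Proof.
rewrite innerZl inner_suml [RHS]innerC innerZl inner_suml; congr (_ * _).
rewrite [RHS](reindex_inj invg_inj) /=; apply: eq_bigr => s _.
by rewrite !innerZl inner_act_perm [in RHS]innerC odd_permV.
Qed.

Let HS := harmonics R n d `&` sgn_polys R n d.

Lemma HS_subspace : is_subspace HS.
Proof.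
have [H0 HD] := @harmonics_subspace R n d; have [S0 SD] := @sgn_polys_subspace R n d.
by split=> // c p q [Hp Sp] [Hq Sq]; split; [apply: HD|apply: SD].
Qed.

Lemma sumprod_inv_mul W p q :
  inv_polys R n d p -> sumprod (inv_polys R n d) W q -> sumprod (inv_polys R n d) W (p * q).
Proof.
move=> Ip [l [Wl ->]]; rewrite mulr_sumr; apply: sumprod_sum => u /Wl[I1 W2] _.
by rewrite mulrA; apply: sumprod_mul => //; apply: inv_polys_mul.
Qed.

Lemma sgn_polys_homog_gen e p :
  sgn_polys R n d p -> p \is e.-homog -> sumprod (inv_polys R n d) HS p.
Proof.
elim/ltn_ind: e p => e IHe p Sp hom_p.
have [h Hh /(coinv_ideal_pihomog e)[l [Wl E]]] := harmonic_decomposition p.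
(* Neither taking the part of degree [e] nor alternating changes [p]. *)
have -> : p = alt (pihomog mdeg e h + pihomog mdeg e (p - h)).
  by rewrite -pihomogD addrC subrK pihomog_dE // alt_id.
rewrite E altD; apply: sumprodD.
  rewrite -[alt _]mul1r; apply: sumprod_mul; first exact: inv_polys1.
  by split; [apply/alt_harmonics/harmonics_pihomog|apply: alt_sgn].
rewrite alt_sum; apply: sumprod_sum => ab /Wl[[Iab _] [i ie hom_ab]] _.
(* The invariant factor leaves [alt]; what remains is alternating of degree [i < e]. *)
rewrite alt_mulr // mulrC; apply: sumprod_inv_mul => //.
by apply: IHe (alt_homog hom_ab) => //; apply: alt_sgn.
Qed.

Lemma sgn_polys_gen : sgn_polys R n d = sumprod (inv_polys R n d) HS.
Proof.
apply/seteqP; split=> [p Sp|p [l [Wl ->]]].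
  rewrite [p](pihomog_partitionE (mf := mdeg) (leqnn _)); apply: sumprod_sum => i _ _.
  by apply: sgn_polys_homog_gen (pihomogP _ _ _); apply: sgn_polys_pihomog.
apply: (subspace_sum (@sgn_polys_subspace R n d)) => u /Wl[I1 [_ S2]] _ s.
by rewrite act_perm_prod I1 S2 scalerAr.
Qed.

End Alternation.

(** Sorted increasingly, distinct naturals have their entry of rank [i] at least [i]. *)
Lemma sum_injective_ge n (a : 'I_n -> nat) :
  injective a -> (\sum_(i < n) i <= \sum_(i < n) a i)%N.
Proof.
move=> inj_a; pose s := sort leq (map a (enum 'I_n)).
have szs : size s = n by rewrite size_sort size_map size_enum_ord.
have lt_s : sorted ltn s.
  by rewrite ltn_sorted_uniq_leq sort_uniq map_inj_uniq // enum_uniq sort_sorted //; apply: leq_total.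
have ge_s i : (i < n)%N -> (i <= nth 0%N s i)%N.
  elim: i => // i IHi lt_in; apply: leq_ltn_trans (IHi (ltnW lt_in)) _.
  by apply: (sorted_ltn_nth ltn_trans) => //; rewrite inE szs // ltnW.
have -> : (\sum_(i < n) a i = \sum_(i < n) nth 0%N s i)%N.
  rewrite -(big_mkord xpredT (nth 0%N s)) -[in RHS]szs -(big_nth 0%N xpredT id).
  by rewrite (perm_big (map a (enum 'I_n))) ?perm_sort // big_map big_enum.
by apply: leq_sum => i _; apply: ge_s.
Qed.

(** * The Vandermonde determinant in one coordinate *)

Section Vandermonde.
Variables (R : realType) (n d : nat) (c0 : 'I_d).
Implicit Types (p q : polyV R n d) (m : 'X_{1..(n * d)}) (s t : 'S_n).

Definition one_column m := forall i j, j != c0 -> m (mxvec_index i j) = 0%N.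

Lemma mdeg_one_column m : one_column m -> mdeg m = (\sum_(i < n) m (mxvec_index i c0))%N.
Proof.
move=> mc0; rewrite mdegE (reindex _ (curry_mxvec_bij n d)) /=.
transitivity (\sum_(i < n) \sum_(j < d) m (mxvec_index i j))%N.
  by rewrite pair_bigA; apply: eq_big => -[].
by apply: eq_bigr => i _; rewrite (bigD1 c0) //= big1 ?addn0 // => j /mc0.
Qed.

(** The degree is too small for the exponents to be distinct, so some transposition of blocks fixes
    [m]; as it negates [p], the coefficient equals its opposite. *)
Lemma sgn_polys_low p m :
  sgn_polys R n d p -> one_column m -> (mdeg m < 'C(n, 2))%N -> p@_m = 0.
Proof.
move=> Sp mc0; rewrite (mdeg_one_column mc0) -bin2_sum big_mkord ltnNge => lt_m.
have [i [i' [ne_i eq_i]]] : exists i i', i != i' /\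
    m (mxvec_index i c0) = m (mxvec_index i' c0).
  apply: contrapT => inj_m; case/negP: lt_m.
  apply: (@sum_injective_ge n (fun i => m (mxvec_index i c0))) => i i' eq_i.
  by apply/eqP/negPn/negP => ne_i; case: inj_m; exists i, i'.
have := congr1 (mcoeff m) (Sp (tperm i i')).
rewrite mcoeff_act_perm mcoeffZ odd_tperm ne_i tpermV expr1 mulN1r.
have -> : [multinom m (block_perm d (tperm i i') k) | k < n * d] = m.
  apply/mnmP => k; rewrite mnmE; case/mxvec_indexP: k => a j; rewrite block_permE.
  have [->|/mc0 m0] := eqVneq j c0; last by rewrite !m0.
  by case: tpermP => [->|->|].
by move/eqP; rewrite -addr_eq0 -mulr2n mulrn_eq0 => /eqP.
Qed.

Definition staircase : 'X_{1..(n * d)} :=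
  (\sum_(i < n) U_(mxvec_index i c0) *+ i)%MM.

Lemma staircaseE i j : staircase (mxvec_index i j) = if j == c0 then i : nat else 0%N.
Proof.
rewrite mnm_sumE (bigD1 i) //= big1 ?addn0 => [|k ne_k]; rewrite mulmnE mnm1E.
  have [->|ne_j] := eqVneq j c0; first by rewrite eqxx mul1n.
  by case: eqP => // /mxvec_index_inj[_ E]; rewrite E eqxx in ne_j.
by case: eqP => // /mxvec_index_inj[E _]; rewrite E eqxx in ne_k.
Qed.

Lemma staircase_one_column : one_column staircase.
Proof. by move=> i j /negPf ne; rewrite staircaseE ne. Qed.

Lemma mdeg_staircase : mdeg staircase = 'C(n, 2).
Proof.
rewrite (mdeg_one_column staircase_one_column) -bin2_sum big_mkord.
by apply: eq_bigr => i _; rewrite staircaseE eqxx.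
Qed.

(** The Leibniz expansion of the Vandermonde determinant in coordinate [c0], divided by $n!$. *)
Definition vandermonde : polyV R n d := alt 'X_[staircase].

(** The staircase has distinct exponents, so only the identity contributes to this coefficient. *)
Lemma vandermonde_staircase : vandermonde@_staircase != 0.
Proof.
rewrite mcoeffZ mulf_neq0 ?invr_eq0 ?card_Sn_neq0 //.
rewrite raddf_sum (bigD1 1%g) //= big1 => [|s ne_s].
  by rewrite addr0 mcoeffZ act_perm1 mcoeffX eqxx mulr1 signr_eq0.
rewrite mcoeffZ mcoeff_act_perm mcoeffX; case: eqP => [/mnmP E|]; last by rewrite mulr0.
case/eqP: ne_s; apply: invg_inj; apply/permP => i; rewrite invg1 perm1.
apply: val_inj; have := E (mxvec_index i c0).
by rewrite mnmE block_permE !staircaseE eqxx.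
Qed.

(** Moving [alt] across the inner product leaves the staircase coefficient of [alt a * b] with [b]
    invariant. Write the staircase as [k1 + k2]: if [k2 = 0], then [b] has no such term; otherwise
    [k1] is too small for [alt a]. *)
Lemma vandermonde_harmonic : harmonics R n d vandermonde.
Proof.
move=> p [l [Wl ->]]; rewrite inner_suml big_seq big1 // => ab /Wl[_ /inv_polys_plusE[I2 z2]].
rewrite innerC inner_alt alt_mulr // innerX mcoeffM big1 ?mul0r // => -[[k1 k1P] [k2 k2P]] /=.
move=> {k1P k2P} /eqP E.
have [->|k2_neq0] := eqVneq k2 0%MM; first by rewrite z2 mulr0.
rewrite (sgn_polys_low (@alt_sgn _ _ _ _)) ?mul0r //.
  move=> i j /(staircase_one_column i); rewrite E mnmDE => /eqP.
  by rewrite addn_eq0 => /andP[/eqP].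
rewrite -mdeg_staircase E mdegD -[X in (X < _)%N]addn0 ltn_add2l lt0n.
by rewrite mdeg_eq0.
Qed.

Lemma max_degree_HS : max_degree (harmonics R n d `&` sgn_polys R n d) 'C(n, 2).
Proof.
split=> [|f [/harmonics_msize]//].
exists vandermonde; first by split; [apply: vandermonde_harmonic|apply: alt_sgn].
apply/eqP; rewrite eqn_leq (harmonics_msize vandermonde_harmonic) -mdeg_staircase.
by rewrite msize_mdeg_lt // mcoeff_msupp vandermonde_staircase.
Qed.

End Vandermonde.

(** * Homogeneous bases and minimal generating families *)

Section Generators.
Variables (R : realType) (n d : nat).
Let HS := harmonics R n d `&` sgn_polys R n d.

(** A maximal free family of homogeneous alternating harmonics spans, because homogeneous components
    of alternating harmonics are again such. *)
Lemma homogeneous_basis : exists k (e : k.-tuple (polyV R n d)),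
  linear_basis HS e /\ forall i, homogeneous (tnth e i).
Proof.
have [k [e [Xe free_e span_e]]] := max_lin_free (X := fun p => HS p /\ homogeneous p)
  (fun k e Xe => msize_lin_free_leq (fun i => harmonics_msize (Xe i).1.1)).
exists k, e; split=> [|i]; last by case: (Xe i).
split=> //; apply/seteqP; split=> [p [Hp Sp]|p [c ->]]; last first.
  apply: (subspace_sum (@HS_subspace R n d)) => i _ _.
  by apply: (subspaceZ (@HS_subspace R n d)); case: (Xe i).
rewrite [p](pihomog_partitionE (mf := mdeg) (leqnn _)).
apply: (subspace_sum (in_span_subspace _)) => i _ _; apply: span_e; split; last first.
  by exists i; apply: pihomogP.
by split; [apply: harmonics_pihomog|apply: sgn_polys_pihomog].
Qed.

Lemma basis_generates k (e : k.-tuple (polyV R n d)) :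
  linear_basis HS e -> generates_sgn [set` e].
Proof.
case=> spanE _; have HSe i : HS (tnth e i) by rewrite spanE; apply: in_span_gen.
rewrite /generates_sgn sgn_polys_gen -/HS; apply/seteqP; split=> p [l [Wl ->]].
  apply: sumprod_sum => -[a b] /Wl /= [Ia HSb] _.
  move: HSb; rewrite spanE => -[c ->]; rewrite mulr_sumr; apply: sumprod_sum => i _ _.
  rewrite -scalerAr scalerAl; apply: sumprod_mul; last exact: mem_tnth.
  by move=> s; rewrite act_permZ Ia.
apply: sumprod_sum => -[a b] /Wl /= [Ia /tnthP[i ->]] _.
exact: sumprod_mul.
Qed.

(** Choose a harmonic part [hp p] of each [p]. If [tnth e i] is a sum of products [a * b], replacing
    each by [a@_0 *: hp b] changes it by an element that is both harmonic and in the ideal, hence 0;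
    so the [hp] of the generators span. *)
Lemma basis_size_min k (e : k.-tuple (polyV R n d)) l (g : l.-tuple (polyV R n d)) :
  linear_basis HS e -> generates_sgn [set` g] -> (k <= l)%N.
Proof.
move=> [spanE free_e] gen_g; have Isub := ideal_subspace (@coinv_idealP R n d).
have Hsub := @harmonics_subspace R n d.
have decomp p : exists h, harmonics R n d h /\ coinv_ideal (p - h).
  by have [h] := harmonic_decomposition p; exists h.
have [hp hpP] := choice decomp.
apply: (lin_free_leq (g := fun j => hp (tnth g j)) free_e) => i.
have [He Se] : HS (tnth e i) by rewrite spanE; apply: in_span_gen.
move: Se; rewrite gen_g => -[s [Ws E]].
pose v := \sum_(ab <- s) ab.1@_0%MM *: hp ab.2.
have <- : v = tnth e i; last first.
  have spanP := in_span_subspace (fun j => hp (tnth g j)).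
  apply: (subspace_sum spanP) => ab /Ws[_ /= /tnthP[j ->]] _.
  exact/(subspaceZ spanP)/(in_span_gen (fun j => hp (tnth g j))).
apply/eqP; rewrite -subr_eq0; apply/eqP/harmonics_coinv0.
  apply: (subspaceB Hsub) => //; apply: (subspace_sum Hsub) => ab _ _.
  by apply: (subspaceZ Hsub); case: (hpP ab.2).
rewrite E /v -sumrB; apply: (subspace_sum Isub) => -[a b] /Ws /= [Ia _] _.
have [_ Ib] := hpP b; set a0 := a@_0%MM.
(* Isolates two elements of the ideal: [b - hp b], and a multiple of [a] minus its constant term. *)
have -> : a0 *: hp b - a * b = - 1 *: (a0 *: (b - hp b) + b * (a - a0 *: 1)).
  rewrite mulrBr -[b * (_ *: 1)]scalerAr mulr1 scalerBr scaleN1r [b * a]mulrC.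
  by rewrite [_ - _ + _]addrC addrA subrK opprB.
apply/(subspaceZ Isub)/(subspaceD Isub); first exact: (subspaceZ Isub).
apply: sumprod_mul => //; apply/inv_polys_plusE; split.
  have invsub := inv_polys_subspace R n d.
  by apply: (subspaceB invsub) => //; apply: (subspaceZ invsub); apply: inv_polys1.
by rewrite mcoeffB mcoeffZ mcoeff1 eqxx mulr1 subrr.
Qed.

End Generators.

Theorem theorem37 (R : realType) (n d : nat) (hn : (2 <= n)%N) (hd : (1 <= d)%N) :
  [/\ sgn_polys R n d =
        sumprod (inv_polys R n d) (harmonics R n d `&` sgn_polys R n d),
      max_degree (harmonics R n d `&` sgn_polys R n d) 'C(n, 2)
    & exists k : nat,
        [/\ has_dimension (harmonics R n d `&` sgn_polys R n d) k,
            min_generators_sgn R n d k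
          & exists e : k.-tuple {mpoly R[n * d]},
              [/\ linear_basis (harmonics R n d `&` sgn_polys R n d) e,
                  forall i : 'I_k, homogeneous (tnth e i)
                & generates_sgn [set` e]]]].
Proof.
(* [hd] supplies the coordinate in which the Vandermonde determinant is formed. *)
split; [exact: sgn_polys_gen|exact: max_degree_HS (Ordinal hd)|].
have [k [e [basis_e hom_e]]] := homogeneous_basis R n d; exists k.
have gen_e := basis_generates basis_e.
split; [by exists e| |by exists e].
by split=> [|l g]; [exists e|apply: basis_size_min basis_e].
Qed.
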